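(* Let $f(x,y)\in\mathbb{C}[x,y]$ be a nonzero binary form of degree $d$ with the factorization $$f(x,y)=\prod_{i=0}^{r}\ell_i(x,y)^{m_i},$$ where $r\ge 1$, the $\ell_i\in\mathbb{C}[x,y]$ are distinct (i.e. pairwise non-proportional) nonzero linear forms, and the $m_i\ge 1$ are integers. Then $$L_{\mathbb{C}}(f)\ \ge\ \max(m_0,\ldots,m_r)+1.$$
   Context: A binary form of degree $d$ is a homogeneous polynomial of degree $d$ in $x,y$. For a field $K\subseteq\mathbb{C}$ and a binary form $f\in K[x,y]$ of degree $d$, the $K$-rank $L_K(f)$ is the smallest $r$ for which there exist $\lambda_j,\alpha_j,\beta_j\in K$ with $f(x,y)=\sum_{j=1}^r\lambda_j(\alpha_jx+\beta_jy)^d$. For $K=\mathbb{C}$ it is called the Waring rank. *)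

(* Defs.v *)
From HB Require Import structures.
From mathcomp Require Import all_boot all_order all_algebra.
From mathcomp Require Import mpoly complex boolp reals.

Set Implicit Arguments.
Unset Strict Implicit.
Unset Printing Implicit Defensive.

Import GRing.Theory.
Local Open Scope ring_scope.

(* Binary forms of degree [d] are the polynomials [f : {mpoly K[2]}] with
   [f \is d.-homog]; the variables x, y are ['X_0] and ['X_1]. *)

Definition linear_form (K : fieldType) (a b : K) : {mpoly K[2]} :=
  a *: 'X_0 + b *: 'X_1.

Definition power_sum_decomp (K : fieldType) (d : nat) (f : {mpoly K[2]})
    (r : nat) : Prop :=
  exists lambda alpha beta : 'I_r -> K,
    f = \sum_(j < r) lambda j *: linear_form (alpha j) (beta j) ^+ d.

Lemma power_sum_decomp_asbool (K : fieldType) (d : nat) (f : {mpoly K[2]}) :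
  (exists r, power_sum_decomp d f r) -> exists r, `[< power_sum_decomp d f r >].
Proof. by move=> [r fr]; exists r; apply/asboolP. Qed.

(* The K-rank L_K(f) of a form [f] of degree [d].  Since f and all coefficients
   are over K, an ambient field containing K is not needed.  The [else] branch
   is immaterial: over a field of characteristic 0, every form of degree d has a
   decomposition. *)
Definition form_rank (K : fieldType) (d : nat) (f : {mpoly K[2]}) : nat :=
  if pselect (exists r, power_sum_decomp d f r) is left ex_r
  then ex_minn (power_sum_decomp_asbool ex_r)
  else 0%N.

Definition proportional (K : fieldType) (p q : {mpoly K[2]}) : Prop :=
  exists c : K, c != 0 /\ p = c *: q.

(* Main.v *)
Require Import Defs.
From HB Require Import structures.
From mathcomp Require Import all_boot all_order all_algebra.
From mathcomp Require Import mpoly complex boolp reals.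
From mathcomp Require Import ring.

(** Restrict [f] to a line [p + T u] with [p] on the zero line of [l i] and
    [l i u = 1]: one gets [T ^ m i * g(T)] with [g(0) != 0].  A decomposition of
    [f] with [s] summands expresses the [k]-th coefficient of this polynomial as
    a binomial multiple of [\sum_j lambda_j A_j ^ (d - k) B_j ^ k].  A sum of [s]
    weighted geometric sequences that vanishes at [0, ..., s - 1] vanishes
    identically, so [s <= m i < d] would force the coefficient at [m i] to
    vanish too.

    That a decomposition exists at all follows by inverting the Vandermonde
    matrix of [0, ..., d], which writes [f] as a combination of the powers
    [(x + j y) ^ d]. *)

Set Implicit Arguments.
Unset Strict Implicit.
Unset Printing Implicit Defensive.

Import GRing.Theory.
Local Open Scope ring_scope.

(** All [g j] are roots of one monic [P] of degree [s]. Reducing ['X^n] modulo [P] thus writes every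
    [g j ^+ n] as a combination of the first [s] powers, with coefficients independent of [j]. *)
Lemma geometric_sum_eq0 (K : fieldType) (s : nat) (c g : 'I_s -> K) :
  (forall k, (k < s)%N -> \sum_(j < s) c j * g j ^+ k = 0) ->
  forall n, \sum_(j < s) c j * g j ^+ n = 0.
Proof.
move=> sum0 n; pose P := \prod_(j < s) ('X - (g j)%:P).
have P_monic : P \is monic by apply: monic_prod_XsubC.
have size_P : size P = s.+1.
  by rewrite /P size_prod_XsubC /index_enum -enumT size_enum_ord.
have P_g j : P.[g j] = 0.
  by rewrite /P horner_prod (bigD1 j) //= !hornerE subrr mul0r.
set q := 'X^n %% P.
have size_q : (size q <= s)%N.
  by rewrite -ltnS -size_P ltn_modp monic_neq0.
have q_g j : g j ^+ n = q.[g j].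
  have := congr1 (horner^~ (g j)) (divp_eq 'X^n P).
  by rewrite !hornerE P_g mulr0 add0r.
under eq_bigr do rewrite q_g (horner_coef_wide _ size_q) mulr_sumr.
rewrite exchange_big /= big1 // => k _.
under eq_bigr do rewrite mulrCA.
by rewrite -mulr_sumr sum0 ?mulr0.
Qed.

(* Summands with [A j = 0] contribute only to the exponent [d] of [B j], which is
   excluded by [n < d]; the others are geometric sequences of ratio
   [B j / A j]. *)
Lemma binary_power_sum_eq0 (K : fieldType) (d s n : nat)
    (c A B : 'I_s -> K) :
  (s <= n < d)%N ->
  (forall k, (k < s)%N -> \sum_(j < s) c j * (A j ^+ (d - k) * B j ^+ k) = 0) ->
  \sum_(j < s) c j * (A j ^+ (d - n) * B j ^+ n) = 0.
Proof.
move=> /andP[le_sn lt_nd] sum0.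
have dehom k j : (k < d)%N ->
    c j * (A j ^+ (d - k) * B j ^+ k) = c j * A j ^+ d * (B j / A j) ^+ k.
  move=> lt_kd; have [->|A_neq0] := eqVneq (A j) 0.
    by rewrite !expr0n subn_eq0 leqNgt lt_kd gtn_eqF ?(leq_ltn_trans _ lt_kd) //;
      rewrite !(mul0r, mulr0).
  rewrite -{2}(subnK (ltnW lt_kd)) exprD -!mulrA exprMn exprVn.
  by rewrite [B j ^+ k * _]mulrC mulVKf // expf_neq0.
under eq_bigr do rewrite dehom //.
apply: geometric_sum_eq0 => k lt_ks; rewrite -[RHS](sum0 k lt_ks).
apply: eq_bigr => j _.
by rewrite dehom // (leq_trans lt_ks) // ltnW // (leq_ltn_trans le_sn).
Qed.

Lemma mdeg2 (t : 'X_{1..2}) : mdeg t = (t 0%R + t 1%R)%N.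
Proof.
rewrite mdegE !big_ord_recl big_ord0 addn0.
by congr (_ + t _)%N; apply/val_inj.
Qed.

Lemma mnm2E (t : 'X_{1..2}) (i j : nat) :
  ((U_(0%R) *+ i + U_(1%R) *+ j)%MM == t) = (i == t 0%R) && (j == t 1%R).
Proof.
apply/eqP/andP => [<-|[/eqP-> /eqP->]].
  by rewrite !mnmDE !mulmnE !mnm1E !eqxx /= !mul1n !mul0n addn0 add0n.
apply/mnmP => -[[|[|//]] lt_k]; rewrite mnmDE !mulmnE !mnm1E;
  rewrite -!val_eqE /= ?mul1n ?mul0n ?addn0 ?add0n; congr (t _); exact/val_inj.
Qed.

Lemma mcoeff_linear_formX (K : fieldType) (d : nat) (a b : K) (t : 'X_{1..2}) :
  mdeg t = d ->
  (linear_form a b ^+ d)@_t = a ^+ t 0 * b ^+ t 1 *+ 'C(d, t 1).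
Proof.
rewrite mdeg2 => deg_t.
have lt_t1 : (t 1%R < d.+1)%N by rewrite ltnS -deg_t leq_addl.
have t0E : t 0 = (d - t 1%R)%N by rewrite -deg_t addnK.
rewrite /linear_form exprDn raddf_sum /= (bigD1 (Ordinal lt_t1)) //= big1 => [|k].
  rewrite addr0 mcoeffMn !exprZn -scalerAl -scalerAr scalerA mcoeffZ.
  by rewrite !mpolyXn -mpolyXD mcoeffX mnm2E /= -t0E !eqxx mulr1.
rewrite -val_eqE /= => /negPf neq_k.
rewrite mcoeffMn !exprZn -scalerAl -scalerAr scalerA mcoeffZ.
by rewrite !mpolyXn -mpolyXD mcoeffX mnm2E neq_k andbF mulr0 mul0rn.
Qed.

Lemma linear_formP (K : fieldType) (p : {mpoly K[2]}) :
  p \is 1.-homog -> p = linear_form p@_U_(0%R) p@_U_(1%R).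
Proof.
move=> p_hom; apply/mpolyP => t; rewrite /linear_form mcoeffD !mcoeffZ !mcoeffX.
have [/eqP/mdeg1P[i /eqP ->]|deg_t] := eqVneq (mdeg t) 1%N.
  have neq01 : ((U_(0%R) : 'X_{1..2}) == U_(1%R))%MM = false.
    by apply/eqP => /mnmP/(_ 0%R); rewrite !mnm1E.
  case: i => -[|[|//]] lt_i; set i := Ordinal _.
    have -> : i = 0 by apply/val_inj.
    by rewrite eqxx eq_sym neq01 mulr1 mulr0 addr0.
  have -> : i = 1 by apply/val_inj.
  by rewrite eqxx neq01 mulr1 mulr0 add0r.
rewrite (dhomog_nemf_coeff p_hom deg_t).
have neq i : (U_(i)%MM == t) = false.
  by apply/eqP => tE; rewrite -tE mdeg1 eqxx in deg_t.
by rewrite !neq !mulr0 addr0.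
Qed.

Lemma power_sum_decomp_exists (K : numFieldType) (d : nat) (f : {mpoly K[2]}) :
  f \is d.-homog -> power_sum_decomp d f d.+1.
Proof.
move=> f_hom; pose t : 'rV[K]_d.+1 := \row_j (j : nat)%:R.
pose V := Vandermonde d.+1 t.
have V_unit : V \in unitmx.
  rewrite unitmxE det_Vandermonde unitfE; apply/prodf_neq0 => i _.
  apply/prodf_neq0 => j lt_ij; rewrite !mxE subr_eq0 Num.Theory.eqr_nat.
  by rewrite gtn_eqF.
(* The coefficient of [(x + j y)^d] at [x^(d-k) y^k] is ['C(d, k) * j^k]; dividing by the binomial,
   nonzero in characteristic 0, leaves a Vandermonde system. *)
pose e : 'cV[K]_d.+1 := \col_k
  (f@_(U_(0%R) *+ (d - k) + U_(1%R) *+ k) / 'C(d, k)%:R).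
pose c := invmx V *m e.
have cE : V *m c = e by rewrite mulKVmx.
exists (fun j => c j 0), (fun=> 1), (fun j => t 0 j).
apply/mpolyP => u; rewrite raddf_sum /=.
under eq_bigr do rewrite mcoeffZ.
have [deg_u|deg_u] := eqVneq (mdeg u) d; last first.
  rewrite (dhomog_nemf_coeff f_hom deg_u) big1 // => j _.
  rewrite (@dhomog_nemf_coeff _ _ _ d _ _ _ deg_u) ?mulr0 //.
  rewrite -[X in X.-homog]mul1n; apply: dhomogMn.
  by apply: dhomogD; apply: dhomogZ; rewrite dhomogX; apply/eqP/mdeg1.
under eq_bigr do rewrite mcoeff_linear_formX // expr1n mul1r.
have u_sum : (u 0%R + u 1%R = d)%N by rewrite -deg_u mdeg2.
have lt_u1 : (u 1%R < d.+1)%N by rewrite ltnS -u_sum leq_addl.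
(* Row [u 1] of the system is the wanted equality of coefficients at [u], up to the binomial. *)
have := congr1 (fun M : 'cV_d.+1 => M (Ordinal lt_u1) 0) cE.
rewrite !mxE /=.
have -> : (U_(0%R) *+ (d - u 1%R) + U_(1%R) *+ u 1%R)%MM = u.
  by apply/eqP; rewrite mnm2E -u_sum addnK !eqxx.
have C_neq0 : 'C(d, u 1%R)%:R != 0 :> K.
  by rewrite Num.Theory.pnatr_eq0 -lt0n bin_gt0.
move=> sumE; rewrite -[f@__](divfK C_neq0) -sumE mulr_suml.
by apply: eq_bigr => j _; rewrite [V _ _]mxE mulr_natr mulrnAr mulrC.
Qed.

(** As a substitution through [mmap] it is a ring morphism, so it passes through both the
    factorization and the sum of powers. *)
Definition line_restriction (K : fieldType) (p u : 'I_2 -> K) :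
    {mpoly K[2]} -> {poly K} :=
  mmap (@polyC K) (fun i => (p i)%:P + u i *: 'X).

HB.instance Definition _ (K : fieldType) (p u : 'I_2 -> K) :=
  GRing.RMorphism.on (line_restriction p u).

Lemma line_restrictionZ (K : fieldType) (p u : 'I_2 -> K) c q :
  line_restriction p u (c *: q) = c *: line_restriction p u q.
Proof. by rewrite /line_restriction mmapZ mul_polyC. Qed.

Lemma line_restriction_prod (K : fieldType) (p u : 'I_2 -> K) (n : nat)
    (l : 'I_n -> {mpoly K[2]}) (m : 'I_n -> nat) :
  line_restriction p u (\prod_(j < n) l j ^+ m j) =
  \prod_(j < n) line_restriction p u (l j) ^+ m j.
Proof. by rewrite rmorph_prod; apply: eq_bigr => j _; rewrite rmorphXn. Qed.

Lemma line_restriction_linear (K : fieldType) (p u : 'I_2 -> K) (a b : K) :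
  line_restriction p u (linear_form a b) =
  (a * p 0 + b * p 1)%:P + (a * u 0 + b * u 1) *: 'X.
Proof.
rewrite /linear_form rmorphD /= !line_restrictionZ /line_restriction !mmapX !mmap1U.
by rewrite -!mul_polyC !polyCD !polyCM; ring.
Qed.

Lemma coef_affineX (K : fieldType) (A B : K) (d k : nat) : (k <= d)%N ->
  ((A%:P + B *: 'X) ^+ d)`_k = A ^+ (d - k) * B ^+ k *+ 'C(d, k).
Proof.
move=> le_kd; rewrite exprDn coef_sum (bigD1 (inord k : 'I_d.+1)) //=.
rewrite inordK ?ltnS // big1 => [|j].
  rewrite addr0 coefMn -polyC_exp exprZn coefCM coefZ coefXn eqxx.
  by rewrite mulr1.
rewrite -val_eqE /= inordK ?ltnS // eq_sym => /negPf neq_kj.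
by rewrite coefMn -polyC_exp exprZn coefCM coefZ coefXn neq_kj !mulr0 mul0rn.
Qed.

(** The factor is [a' / a] or [b' / b], whichever denominator is nonzero; were it 0, the form
    [linear_form a' b'] would vanish. *)
Lemma linear_form_proportional (K : fieldType) (a b a' b' : K) :
  linear_form a b != 0 -> linear_form a' b' != 0 -> a' * b = b' * a ->
  proportional (linear_form a' b') (linear_form a b).
Proof.
have prop c : linear_form a' b' != 0 -> a' = c * a -> b' = c * b ->
    proportional (linear_form a' b') (linear_form a b).
  move=> l_neq0 a'E b'E; exists c; split; last first.
    by rewrite /linear_form a'E b'E scalerDr !scalerA.
  apply: contra_neq l_neq0 => c0.
  by rewrite /linear_form a'E b'E c0 !mul0r !scale0r addr0.
move=> l_neq0 l'_neq0 det0.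
have [a0|a_neq0] := eqVneq a 0; last first.
  apply: (prop (a' / a)) => //; first by rewrite divfK.
  by rewrite mulrAC det0 mulfK.
have b_neq0 : b != 0.
  by apply: contra_neq l_neq0 => b0; rewrite /linear_form a0 b0 !scale0r addr0.
apply: (prop (b' / b)) => //; last by rewrite divfK.
by apply: (mulIf b_neq0); rewrite det0 a0 !mulr0 mul0r.
Qed.

(** The condition [m i < d] excludes pure powers [l i ^+ d], for which a single summand suffices. *)
Lemma power_sum_decomp_lower_bound (K : numFieldType) (d r : nat)
    (l : 'I_r.+1 -> {mpoly K[2]}) (m : 'I_r.+1 -> nat) (i : 'I_r.+1) (s : nat) :
  (forall j, l j \is 1.-homog) -> (forall j, l j != 0) ->
  (forall j, j != i -> ~ proportional (l j) (l i)) ->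
  (m i < d)%N ->
  power_sum_decomp d (\prod_(j < r.+1) l j ^+ m j) s -> (m i < s)%N.
Proof.
move=> l_lin l_neq0 l_dist lt_md [c [al [be decomp]]].
rewrite ltnNge; apply/negP => le_sm.
pose a j := (l j)@_U_(0%R); pose b j := (l j)@_U_(1%R).
have lE j : l j = linear_form (a j) (b j) by apply: linear_formP.
have [u u_i] : exists u : 'I_2 -> K, a i * u 0 + b i * u 1 = 1.
  have [a0|a_neq0] := eqVneq (a i) 0; last first.
    exists (fun k => if k == 0 then (a i)^-1 else 0).
    by rewrite /= mulfV // mulr0 addr0.
  have b_neq0 : b i != 0.
    apply: contra_neq (l_neq0 i) => b0.
    by rewrite lE /linear_form a0 b0 !scale0r addr0.
  exists (fun k => if k == 0 then 0 else (b i)^-1).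
  by rewrite /= mulfV // mulr0 add0r.
(* With this point on the zero line of [l i], the value of [l j] at [p] is the determinant of the
   coefficients of [l i] and [l j]. *)
pose p k := if k == 0 :> 'I_2 then - b i else a i.
pose rho := line_restriction p u.
have rho_i : rho (l i) = 'X.
  rewrite lE /rho line_restriction_linear u_i scale1r /p /=.
  by rewrite mulrN [b i * _]mulrC addNr add0r.
set f := \prod_(j < r.+1) _ in decomp.
pose g := \prod_(j < r.+1 | j != i) rho (l j) ^+ m j.
have rho_f : rho f = 'X^(m i) * g.
  by rewrite /rho /f line_restriction_prod (bigD1 i) //= -/rho rho_i.
(* A factor of [g] vanishing at 0 would make this determinant 0, hence [l j] proportional to
   [l i]. *)
have g0 : g`_0 != 0.
  rewrite -horner_coef0 horner_prod; apply/prodf_neq0 => j neq_ji.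
  rewrite horner_exp expf_neq0 // lE /rho line_restriction_linear /p /=.
  rewrite !hornerE mulrN addrC subr_eq0.
  apply/eqP => det0; apply: (l_dist j neq_ji); rewrite !lE.
  by apply: linear_form_proportional; rewrite -?lE.
(* The [j]-th form of the decomposition restricts to [A j + B j * 'X]. *)
pose A j := al j * p 0 + be j * p 1.
pose B j := al j * u 0 + be j * u 1.
have coef_f k : (k <= d)%N ->
    (rho f)`_k = (\sum_(j < s) c j * (A j ^+ (d - k) * B j ^+ k)) *+ 'C(d, k).
  move=> le_kd; rewrite decomp /rho raddf_sum coef_sum -sumrMnl /=.
  apply: eq_bigr => j _; rewrite line_restrictionZ rmorphXn /=.
  by rewrite line_restriction_linear coefZ coef_affineX // mulrnAr.
move: g0; have := coef_f _ (ltnW lt_md).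
rewrite rho_f coefXnM ltnn subnn => ->.
rewrite (@binary_power_sum_eq0 K d s (m i)) ?mul0rn ?eqxx ?le_sm //.
(* For [k < s <= m i] the factor ['X^(m i)] kills the [k]-th coefficient, and the nonzero binomial
   cancels. *)
move=> k lt_ks; have lt_km := leq_trans lt_ks le_sm.
have le_kd : (k <= d)%N by rewrite ltnW // (ltn_trans lt_km).
have := coef_f _ le_kd; rewrite rho_f coefXnM lt_km => /esym/eqP.
rewrite -mulr_natr mulf_eq0 Num.Theory.pnatr_eq0 eqn0Ngt bin_gt0 le_kd orbF.
by move/eqP.
Qed.

(** Existence of a decomposition rules out the default value 0, so the minimum is attained. *)
Lemma form_rank_decomp (K : numFieldType) (d : nat) (f : {mpoly K[2]}) :
  f \is d.-homog -> power_sum_decomp d f (form_rank d f).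
Proof.
move=> f_hom; rewrite /form_rank; case: pselect => [ex_r|[]].
  by case: ex_minnP => s /asboolP.
by exists d.+1; apply: power_sum_decomp_exists.
Qed.

Lemma dhomog_prod_linear (K : fieldType) (n r : nat)
    (l : 'I_r -> {mpoly K[n]}) (m : 'I_r -> nat) :
  (forall i, l i \is 1.-homog) ->
  \prod_(i < r) l i ^+ m i \is (\sum_(i < r) m i)%N.-homog.
Proof.
move=> l_lin; apply: (big_ind2 (fun p e => p \is e.-homog)).
- exact: dhomog1.
- by move=> p1 e1 p2 e2; apply: dhomogM.
- by move=> i _; rewrite -[X in X.-homog]mul1n; apply: dhomogMn.
Qed.

Theorem theorem3p1 (R : realType) (d r : nat) (f : {mpoly R[i][2]})
    (l : 'I_r.+1 -> {mpoly R[i][2]}) (m : 'I_r.+1 -> nat)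
    (f_form : f \is d.-homog) (f_neq0 : f != 0)
    (r_ge1 : (1 <= r)%N)
    (l_linear : forall i, l i \is 1.-homog) (l_neq0 : forall i, l i != 0)
    (l_distinct : forall i j, i != j -> ~ proportional (l i) (l j))
    (m_ge1 : forall i, (1 <= m i)%N)
    (f_factor : f = \prod_(i < r.+1) l i ^+ m i) :
  ((\max_(i < r.+1) m i) + 1 <= form_rank d f)%N.
Proof.
have dE : d = (\sum_(i < r.+1) m i)%N.
  by apply: (dhomog_uniq f_neq0 f_form); rewrite f_factor dhomog_prod_linear.
have [|i ->] := @eq_bigmax 'I_r.+1 m; first by rewrite card_ord.
rewrite addn1; have := form_rank_decomp f_form; rewrite {1}f_factor.
apply: power_sum_decomp_lower_bound => //; first by move=> j; apply: l_distinct.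
(* As [1 <= r] there is a second factor; its exponent, at least 1, forces [m i < d]. *)
have [j neq_ji] : exists j : 'I_r.+1, j != i.
  exists (if i == ord0 then ord_max else ord0).
  by case: ifP => [/eqP ->|/negbT]; [rewrite -val_eqE /= -lt0n | rewrite eq_sym].
rewrite dE (bigD1 i) //= (bigD1 j) //= -addn1 leq_add2l.
exact: leq_trans (m_ge1 j) (leq_addr _ _).
Qed.
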